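(* Let $\varphi,\psi$ be functions of $x$ and $\alpha$ a constant such that $$\frac{\psi''}{\psi}=\frac{\varphi''}{\varphi}=-2\psi\varphi+2x,\qquad \varphi'\psi-\varphi\psi'=2\alpha .$$ Define $a_0=\varphi$, $b_0=\psi$ and, for $n\ge1$, $$a_n=a_{n-1}'+\psi\sum_{\substack{i+j=n-2\\ i,j\ge0}}a_ia_j,\qquad b_n=b_{n-1}'+\varphi\sum_{\substack{i+j=n-2\\ i,j\ge0}}b_ib_j .$$ Then the formal series $F_\infty(x,t)=\sum_{n=0}^\infty a_n(x)t^{-n}$ and $G_\infty(x,t)=\sum_{n=0}^\infty b_n(x)t^{-n}$ formally satisfy, respectively, the Riccati equations $$2t\frac{\partial F}{\partial t}=-(\psi'-t\psi)F^2+\left(\frac{\psi''}{\psi}t+2-t^3\right)F+t^2(\varphi'+t\varphi),$$ $$2t\frac{\partial G}{\partial t}=-(\varphi'-t\varphi)G^2+\left(\frac{\varphi''}{\varphi}t+2-t^3\right)G+t^2(\psi'+t\psi).$$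
   Context: A prime denotes $d/dx$. The functions $\varphi,\psi$ are holomorphic and nowhere zero on a domain $D\subset\mathbb{C}$, and $\alpha\in\mathbb{C}$. ''Formally'' means as identities of formal Laurent series in $t^{-1}$ with coefficients holomorphic functions of $x$ on $D$, with derivatives acting termwise. *)

(* Defs.v *)
From HB Require Import structures.
From mathcomp Require Import all_boot all_order all_algebra.
From mathcomp Require Import all_classical all_reals all_analysis.
From mathcomp Require Import complex.
Set Implicit Arguments.
Unset Strict Implicit.
Unset Printing Implicit Defensive.
Import Order.TTheory GRing.Theory Num.Theory.
Import numFieldNormedType.Exports.
Local Open Scope classical_set_scope.
Local Open Scope ring_scope.

(* R[i] seen as a normed module over itself, so that [open], [derivable] and
   the derivative refer to the topology of the modulus and to complex
   difference quotients. *)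
Notation Cplx R := ((complex R)^o) (only parsing).

Section ComplexFunctions.
Variable R : realType.
Implicit Types (D : set (Cplx R)) (f df p q : Cplx R -> Cplx R).

Definition domain D := [/\ open D, connected D & D !=set0].

Definition derivative_on D f df := forall x, D x -> is_derive x 1 f (df x).

Definition holomorphic_on D f := forall x, D x -> derivable f x 1.

(* The condition i + j = n - 2 is written i + j + 2 = n to avoid truncated
   subtraction; it forces i, j < n and is never met when n = 1. *)
Definition coef_recurrence D p q (a : nat -> Cplx R -> Cplx R) :=
  (forall x, D x -> a 0 x = p x) /\
  (forall n x, (0 < n)%N -> D x ->
    a n x = (a n.-1)^`()%classic x
      + q x * \sum_(i < n) \sum_(j < n | (i + j).+2 == n) a i x * a j x).

End ComplexFunctions.

Section FormalLaurentSeries.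
Variable A : pzRingType.

(* [Laurent N c] is t^N * \sum_k c_k t^(-k).  This representation of a formal
   Laurent series in t^(-1) is not unique: only the coefficients [lcoef] are
   meaningful. *)
Record laurent := Laurent { lorder : int; lcoefs : nat -> A }.

Implicit Types L M : laurent.

(* the coefficient of t^m *)
Definition lcoef L (m : int) : A :=
  if m <= lorder L then lcoefs L `|lorder L - m|%N else 0.

Definition lconst (c : A) := Laurent 0 (fun k => if k == 0%N then c else 0).

Definition lmono (m : int) := Laurent m (fun k => if k == 0%N then 1 else 0).

Definition ladd L M :=
  let N := Num.max (lorder L) (lorder M) in
  Laurent N (fun k => lcoef L (N - k%:Z) + lcoef M (N - k%:Z)).

Definition lopp L := Laurent (lorder L) (fun k => - lcoefs L k).

Definition lmul L M :=
  Laurent (lorder L + lorder M)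
    (fun k => \sum_(i < k.+1) lcoefs L i * lcoefs M (k - i)%N).

(* d/dt *)
Definition lderiv L :=
  Laurent (lorder L - 1) (fun k => lcoefs L k *~ (lorder L - k%:Z)).

Definition lseries (a : nat -> A) := Laurent 0 a.

End FormalLaurentSeries.

Declare Scope laurent_scope.
Delimit Scope laurent_scope with L.
Bind Scope laurent_scope with laurent.
Notation "L + M" := (ladd L M) : laurent_scope.
Notation "- L" := (lopp L) : laurent_scope.
Notation "L - M" := (ladd L (lopp M)) : laurent_scope.
Notation "L * M" := (lmul L M) : laurent_scope.
Notation "c %:L" := (lconst c) (at level 1, format "c %:L") : laurent_scope.
Notation "''t^' m" := (lmono _ m)
  (at level 1, m at level 1, format "''t^' m") : laurent_scope.

Definition laurent_eq_on (R : realType) (D : set (Cplx R))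
    (L M : laurent (Cplx R -> Cplx R)) :=
  forall (m : int) x, D x -> lcoef L m x = lcoef M m x.

(* Main.v *)
(* Fix x and write c_n for the coefficients of F^2, and u = psi''/psi.  Comparing
   coefficients of t^(-n) and using the recurrence a_(n+3) = a_(n+2)' + psi c_(n+1),
   the Riccati equation becomes a closed formula for derivatives,
     a_(n+2)' = 2(n+1) a_n - psi' c_n + u a_(n+1),
   together with a_0' = phi' and a_1' = u a_0.  This formula is proved by strong
   induction: it expresses a_(n+3) = a_(n+2)' + psi c_(n+1) through functions
   already known to be differentiable, and differentiating that expression and
   substituting the formula for smaller indices gives the next instance, because
   psi'' = u psi and u' = 2 - 2(phi psi)'. *)

Require Import Defs.
From HB Require Import structures.
From mathcomp Require Import all_boot all_order all_algebra.
From mathcomp Require Import all_classical all_reals all_analysis.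
From mathcomp Require Import complex ring zify.
Set Implicit Arguments.
Unset Strict Implicit.
Import Order.TTheory GRing.Theory Num.Theory.
Import numFieldNormedType.Exports.
Local Open Scope classical_set_scope.
Local Open Scope ring_scope.

(** * Cauchy products of sequences *)

Definition conv (A : pzRingType) (f g : nat -> A) (n : nat) : A :=
  \sum_(i < n.+1) f i * g (n - i)%N.

Section Convolution.
Variable A : comPzRingType.
Implicit Types f g h : nat -> A.

Lemma eq_conv f f' g n : (forall i, (i <= n)%N -> f i = f' i) ->
  conv f g n = conv f' g n.
Proof. by move=> ff'; apply: eq_bigr => i _; rewrite ff'// -ltnS. Qed.

Lemma convC f g n : conv f g n = conv g f n.
Proof.
rewrite /conv [LHS](reindex_inj rev_ord_inj)/=; apply: eq_bigr => i _.
by rewrite mulrC subSS subKn// -ltnS.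
Qed.

Lemma conv0 f g : conv f g 0 = f 0%N * g 0%N.
Proof. by rewrite /conv big_ord1. Qed.

Lemma convS f g n : conv f g n.+1 = f 0%N * g n.+1 + conv (f \o S) g n.
Proof. by rewrite /conv big_ord_recl. Qed.

Lemma convDl f g h n :
  conv (fun i => f i + g i) h n = conv f h n + conv g h n.
Proof. by rewrite /conv -big_split; apply: eq_bigr => i _; rewrite mulrDl. Qed.

Lemma convZl (c : A) f g n : conv (fun i => c * f i) g n = c * conv f g n.
Proof. by rewrite /conv mulr_sumr; apply: eq_bigr => i _; rewrite mulrA. Qed.

(** Symmetrization: the weights of the indices [i] and [n - i] average to the constant
    [(i + 1) + (n - i + 1) = n + 2]. *)
Lemma conv_weight f n :
  conv (fun i => (2 * i.+1)%:R * f i) f n = n.+2%:R * conv f f n.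
Proof.
have -> : conv (fun i => (2 * i.+1)%:R * f i) f n =
    conv (fun i => i.+1%:R * f i) f n + conv f (fun i => i.+1%:R * f i) n.
  rewrite [X in _ = _ + X]convC -convDl; apply: eq_conv => i _.
  by rewrite -mulrDl -natrD addnn mul2n.
rewrite /conv -big_split mulr_sumr; apply: eq_bigr => i _ /=.
have -> : n.+2 = (i.+1 + (n - i).+1)%N by have := ltn_ord i; lia.
by rewrite natrD; ring.
Qed.

End Convolution.

(** * Complex derivatives of Cauchy products *)

Section Derivatives.
Variable K : numFieldType.
Implicit Types (D : set K^o) (f g : K^o -> K^o).

Lemma is_derive_mul f g (df dg x : K^o) :
  is_derive x 1 f df -> is_derive x 1 g dg ->
  is_derive x 1 (f * g) (df * g x + f x * dg).
Proof.
move=> ? ?; apply: is_derive_eq; rewrite addrC; congr (_ + _).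
exact: mulrC.
Qed.

Lemma convE (a b : nat -> K^o -> K^o) n x :
  conv a b n x = conv (a^~ x) (b^~ x) n.
Proof. by rewrite /conv fct_sumE. Qed.

Lemma is_derive_conv (a b da db : nat -> K^o -> K^o) n (x : K^o) :
  (forall i, (i <= n)%N -> is_derive x 1 (a i) (da i x)) ->
  (forall i, (i <= n)%N -> is_derive x 1 (b i) (db i x)) ->
  is_derive x 1 (conv a b n)
    (conv (da^~ x) (b^~ x) n + conv (a^~ x) (db^~ x) n).
Proof.
move=> da_ db_; rewrite /conv -big_split; apply: is_derive_sum => i /=.
by apply: is_derive_mul;
  [apply: da_; rewrite -ltnS|apply: db_; rewrite leq_subr].
Qed.

(** Differentiability is local and an open [D] is a neighbourhood of each of its points; the
    recurrence and the formula for [u] are only known on [D]. *)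
Lemma is_derive_open D f g (df dg x : K^o) : open D -> D x ->
  {in D, f =1 g} -> is_derive x 1 g dg -> dg = df -> is_derive x 1 f df.
Proof.
move=> oD Dx fg dgx <-; apply: near_eq_is_derive dgx.
near=> y; rewrite fg// inE; near: y; exact: open_nbhs_nbhs.
Unshelve. all: by end_near. Qed.

End Derivatives.

(** * The algebraic identity behind the induction *)

Section Recurrence.
Variable K : comNzRingType.

(* [dcoef n] is the expression that the coefficient of t^(2 - n) in the Riccati
   equation prescribes for the derivative of a_n. *)
Definition dcoef (p' q' u : K) (a : nat -> K) (n : nat) : K :=
  match n with
  | 0 => p'
  | 1 => u * a 0%N
  | m.+2 => (2 * m.+1)%:R * a m - q' * conv a a m + u * a m.+1
  end.

(* The left-hand side is the derivative of a_(n+3) = e_(n+2) + q c_(n+1), computed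
   with e_i as the derivative of a_i for i <= n+1, and q'' = u q. *)
Lemma dcoef_step (p' q q' u u' : K) (a : nat -> K) (n : nat) :
  let e := dcoef p' q' u a in let c := conv a a in
  u' = 2%:R - 2%:R * (q' * a 0%N + q * p') ->
  a 1%N = p' -> (forall k, (k <= n)%N -> a k.+2 = e k.+1 + q * c k) ->
  (2 * n.+1)%:R * e n - (u * q * c n + q' * (2%:R * conv e a n))
    + (u' * a n.+1 + u * e n.+1) + (q' * c n.+1 + q * (2%:R * conv e a n.+1))
  = e n.+3.
Proof.
move=> e c du a1 aS.
(* For [n = 0] the sums only involve [e 0] and [e 1], which have their own formulas, so direct
   expansion suffices. *)
case: n aS => [|n] aS.
  rewrite /e /c !convS !conv0 /= (aS 0%N)// /e /c /=.
  by rewrite !convS !conv0 /= a1 du; ring.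
(* Past [e 0] and [e 1] the general branch of [dcoef] applies, and its weights [2 (i + 1)] are
   summed by [conv_weight]. *)
have sum_e2 : conv (e \o S \o S) a n =
    n.+2%:R * c n - q' * conv c a n + u * conv (a \o S) a n.
  rewrite -conv_weight -!convZl -mulN1r -convZl -!convDl; apply: eq_conv => i _.
  by rewrite /e /c /=; ring.
(* Here [e] is eliminated through the recurrence instead: the resulting [q * conv c a n], multiplied
   by [2 q'], cancels the term [q' * conv c a n] of [sum_e2], multiplied by [2 q]. *)
have sum_e1 : conv (e \o S) a n = conv (a \o S \o S) a n - q * conv c a n.
  rewrite -convZl -mulN1r -convZl -convDl; apply: eq_conv => i le_in /=.
  by rewrite aS ?mulN1r ?addrK// leqW.
have e1 : e n.+1 = a n.+2 - q * c n by rewrite aS ?addrK.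
have e2 : e n.+2 = a n.+3 - q * c n.+1 by rewrite aS ?addrK.
have -> : e n.+4 = (2 * n.+3)%:R * a n.+2 - q' * c n.+2 + u * a n.+3 by [].
rewrite e1 e2 du [conv e a n.+2]convS convS sum_e2 [conv e a n.+1]convS sum_e1.
rewrite /=.
have cS : c n.+1 = a 0%N * a n.+1 + conv (a \o S) a n by rewrite /c convS.
have cSS : c n.+2 = a 0%N * a n.+2 + (a 1%N * a n.+1 + conv (a \o S \o S) a n).
  by rewrite /c !convS.
rewrite cSS cS a1; ring.
Qed.
End Recurrence.

(** * Closed formula for the derivatives of the coefficients *)

Section CoefficientDerivatives.
Variables (K : numFieldType) (D : set K^o).
Variables (p p' q q' u u' : K^o -> K^o) (a : nat -> K^o -> K^o).
Hypothesis oD : open D.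
Hypothesis dp : forall x, D x -> is_derive x 1 p (p' x).
Hypothesis dp' : forall x, D x -> is_derive x 1 p' (u x * p x).
Hypothesis dq : forall x, D x -> is_derive x 1 q (q' x).
Hypothesis dq' : forall x, D x -> is_derive x 1 q' (u x * q x).
Hypothesis du : forall x, D x -> is_derive x 1 u (u' x).
Hypothesis u'E : forall x, D x -> u' x = 2 - 2 * (q' x * p x + q x * p' x).
Hypothesis a0 : forall x, D x -> a 0 x = p x.
Hypothesis a1 : forall x, D x -> a 1 x = (a 0)^`()%classic x.
Hypothesis aS : forall n x, D x ->
  a n.+2 x = (a n.+1)^`()%classic x + q x * conv (a^~ x) (a^~ x) n.

Let e n x : K := @dcoef K (p' x) (q' x) (u x) (a^~ x) n.

Lemma is_derive_coef n x : D x -> is_derive x 1 (a n) (e n x).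
Proof.
elim/ltn_ind: n x => n IH x Dx.
(* Stated at every [y] of [D], because the recurrence must be rewritten on a whole neighbourhood of
   [x] before being differentiated. *)
have derE i y : (i < n)%N -> D y -> (a i)^`()%classic y = e i y.
  by move=> lt_in Dy; rewrite derive1E; have [] := IH i lt_in y Dy.
have d_conv k : (k < n)%N ->
    is_derive x 1 (conv a a k) (2 * conv (e^~ x) (a^~ x) k).
  move=> lt_kn; apply: is_derive_eq.
    apply: is_derive_conv => i le_ik; exact: IH (leq_ltn_trans le_ik lt_kn) _ Dx.
  by rewrite [X in _ + X]convC -mulr2n mulr_natl.
case: n => [|[|[|n]]] in IH derE d_conv *.
- have a0E : {in D, a 0%N =1 p} by move=> y; rewrite inE => /a0.
  exact: (is_derive_open oD Dx a0E (dp Dx)).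
- have a1E : {in D, a 1%N =1 p'}.
    by move=> y; rewrite inE => Dy; rewrite a1// derE.
  by apply: (is_derive_open oD Dx a1E (dp' Dx)); rewrite /e /= (a0 Dx).
(* The index 2 is separate because [a 2] involves [e 1], which is not given by the general branch of
   [dcoef]. *)
- have a2E : {in D, a 2%N =1 u * a 0%N + q * conv a a 0}.
    by move=> y; rewrite inE => Dy; rewrite aS// derE// /e /= !fctE convE.
  have d2 := is_deriveD (is_derive_mul (du Dx) (IH 0%N isT x Dx))
    (is_derive_mul (dq Dx) (d_conv 0%N isT)).
  apply: (is_derive_open oD Dx a2E d2).
  by rewrite convE !conv0 /e /= u'E// a1// derE// /e /= conv0 (a0 Dx); ring.
- have aSE : {in D, a n.+3 =1 cst (2 * n.+1)%:R * a n - q' * conv a a n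
      + u * a n.+1 + q * conv a a n.+1}.
    by move=> y; rewrite inE => Dy; rewrite aS// derE// /e /= !fctE !convE.
  have [lt0 lt1] : (n < n.+3)%N /\ (n.+1 < n.+3)%N by rewrite !ltnS leqW.
  have dS := is_deriveD (is_deriveD (is_deriveB
      (is_derive_mul (is_derive_cst ((2 * n.+1)%:R : K^o) x 1) (IH n lt0 x Dx))
      (is_derive_mul (dq' Dx) (d_conv n lt0)))
      (is_derive_mul (du Dx) (IH n.+1 lt1 x Dx)))
      (is_derive_mul (dq Dx) (d_conv n.+1 lt1)).
  apply: (is_derive_open oD Dx aSE dS).
  rewrite !convE.
  rewrite /e -(@dcoef_step K _ (q x) _ _ (u' x)).
  + rewrite /e/=; ring.
  + by rewrite u'E// (a0 Dx).
  + by rewrite a1// derE.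
  + by move=> k le_kn; rewrite aS// derE// !ltnS leqW.
Qed.
End CoefficientDerivatives.

(** * Coefficient calculus for Laurent series *)

Section LaurentCoefficients.
Variable A : pzRingType.
Implicit Types L M N : laurent A.

Lemma lcoef_gt L m : lorder L < m -> lcoef L m = 0.
Proof. by move=> lt_m; rewrite /lcoef leNgt lt_m. Qed.

Lemma lcoef_sub L k : lcoef L (lorder L - k%:Z) = lcoefs L k.
Proof. by rewrite /lcoef ifT; [congr lcoefs|]; lia. Qed.

Lemma lcoef_series (a : nat -> A) n : lcoef (lseries a) (- n%:Z) = a n.
Proof. by have := lcoef_sub (lseries a) n; rewrite /= sub0r. Qed.

Lemma lcoefD L M m : lcoef (L + M)%L m = lcoef L m + lcoef M m.
Proof.
rewrite {1}/lcoef /=; case: ifPn => [le_m|]; last first.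
  by rewrite -ltNge gt_max => /andP[? ?]; rewrite !lcoef_gt ?addr0.
by congr (lcoef _ _ + lcoef _ _); lia.
Qed.

Lemma lcoefN L m : lcoef (- L)%L m = - lcoef L m.
Proof. by rewrite /lcoef /=; case: ifP; rewrite ?oppr0. Qed.

Lemma lcoef_deriv L m : lcoef (lderiv L) m = lcoef L (m + 1) *~ (m + 1).
Proof.
rewrite /lcoef /= lerBrDr; case: ifP => [le_m|]; last by rewrite mul0rz.
by congr (lcoefs L _ *~ _); lia.
Qed.

(* Any [n] above the order of [L] and any long enough range give the same sum,
   which is thus insensitive to the choice of representatives. *)
Lemma lcoefM L M (m n : int) (K : nat) :
  lorder L <= n -> n + lorder M - m < K%:Z ->
  lcoef (L * M)%L m =
  \sum_(i < K) lcoef L (n - i%:Z) * lcoef M (m - n + i%:Z).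
Proof.
move=> le_Ln lt_K; rewrite {1}/lcoef /=; case: ifPn => [le_m|]; last first.
  rewrite -ltNge => lt_m; rewrite big1// => i _.
  have [?|?] := ltP (lorder L) (n - i%:Z); first by rewrite lcoef_gt ?mul0r.
  by rewrite [lcoef M _]lcoef_gt ?mulr0//; lia.
(* The range splits in three: [j] indices above the order of [L], the [p + 1] terms of the sum in
   [lmul], and indices above the order of [M]. *)
pose j := absz (n - lorder L)%R; pose p := absz (lorder L + lorder M - m)%R.
have -> : K = (j + (p.+1 + (K - (j + p.+1))))%N by rewrite /j /p; lia.
rewrite big_split_ord/= [X in _ = X + _]big1 ?add0r => [|i _]; last first.
  by rewrite lcoef_gt ?mul0r//; have := ltn_ord i; rewrite /j; lia.
rewrite big_split_ord/= [X in _ = _ + X]big1 ?addr0 => [|i _]; last first.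
  by rewrite [lcoef M _]lcoef_gt ?mulr0//; rewrite /j /p; lia.
apply: eq_bigr => -[i lt_ip] _ /=; rewrite -!lcoef_sub.
by congr (lcoef _ _ * lcoef _ _); rewrite /j /p in lt_ip *; lia.
Qed.

(** Needed because representatives are not unique; an [n] above both orders turns both products into
    sums over the same range. *)
Lemma lcoefMl L L' M m : (forall k, lcoef L k = lcoef L' k) ->
  lcoef (L * M)%L m = lcoef (L' * M)%L m.
Proof.
move=> LL'; pose n := Num.max (lorder L) (lorder L').
pose K := (absz (n + lorder M - m)%R).+1.
rewrite !(@lcoefM _ _ m n K); try (rewrite /n /K; lia).
by apply: eq_bigr => i _; rewrite LL'.
Qed.

Lemma lcoefMDl L L' M m :
  lcoef ((L + L') * M)%L m = lcoef (L * M)%L m + lcoef (L' * M)%L m.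
Proof.
pose n := Num.max (lorder L) (lorder L').
pose K := (absz (n + lorder M - m)%R).+1.
rewrite !(@lcoefM _ _ m n K); try (rewrite /n /K /=; lia).
by rewrite -big_split; apply: eq_bigr => i _; rewrite lcoefD mulrDl.
Qed.

Lemma lcoefMNl L M m : lcoef (- L * M)%L m = - lcoef (L * M)%L m.
Proof.
pose n := lorder L; pose K := (absz (n + lorder M - m)%R).+1.
rewrite !(@lcoefM _ _ m n K); try (rewrite /n /K /=; lia).
by rewrite -sumrN; apply: eq_bigr => i _; rewrite lcoefN mulNr.
Qed.

(* [c%:L] and ['t^k] are convertible to [lterm c 0] and [lterm 1 k]. *)
Definition lterm (c : A) (k : int) :=
  Laurent k (fun i => if i == 0%N then c else 0).

Lemma lcoef_term c k m : lcoef (lterm c k) m = if m == k then c else 0.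
Proof.
rewrite /lcoef /=; case: (eqVneq m k) => [->|neq_mk].
  by rewrite lexx subrr.
by case: ifPn => // le_mk; case: eqP => //; lia.
Qed.

Lemma lcoefM_term c k L m : lcoef (lterm c k * L)%L m = c * lcoef L (m - k).
Proof.
rewrite /lcoef /= lerBlDl; case: ifP; last by rewrite mulr0.
move=> le_m; rewrite big_ord_recl /= big1 ?addr0 ?subn0; last first.
  by move=> i _; rewrite mul0r.
by congr (_ * lcoefs _ _); lia.
Qed.

Lemma lcoefM_term2 c d k l L m :
  lcoef (lterm c k * lterm d l * L)%L m = c * d * lcoef L (m - (k + l)).
Proof.
rewrite -lcoefM_term; apply: lcoefMl => j.
by rewrite lcoefM_term !lcoef_term subr_eq addrC; case: ifP; rewrite ?mulr0.
Qed.

Lemma lcoef_series_gt0 (a : nat -> A) m : 0 < m -> lcoef (lseries a) m = 0.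
Proof. by move=> m_gt0; rewrite lcoef_gt. Qed.

Lemma lcoef_series_mul (a b : nat -> A) m :
  lcoef (lseries a * lseries b)%L m = lcoef (lseries (conv a b)) m.
Proof. by []. Qed.

Lemma lcoef_riccati_lhs L m :
  lcoef (2%:R%:L * 't^1 * lderiv L)%L m = 2 * (lcoef L m *~ m).
Proof. by rewrite lcoefM_term2 lcoef_deriv mulr1 add0r subrK. Qed.

Lemma lcoef_riccati_rhs (p p' q q' u : A) L m :
  lcoef (- (q'%:L - 't^1 * q%:L) * (L * L)
         + (u%:L * 't^1 + 2%:R%:L - 't^3) * L
         + 't^2 * (p'%:L + 't^1 * p%:L))%L m =
  - (q' * lcoef (L * L)%L m - q * lcoef (L * L)%L (m - 1))
  + (u * lcoef L (m - 1) + 2 * lcoef L m - lcoef L (m - 3))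
  + ((if m == 2 then p' else 0) + (if m == 3 then p else 0)).
Proof.
rewrite !lcoefD lcoefMNl !lcoefMDl !lcoefMNl !lcoefM_term2.
rewrite !lcoefM_term lcoefD lcoefM_term !lcoef_term !subr_eq0 !subr_eq.
by rewrite !subr0 !mul1r mulr1 add0r.
Qed.

End LaurentCoefficients.

(** * The Riccati equation, one power of [t] at a time *)

Section RiccatiSolution.
Variables (R : realType) (D : set (Cplx R)).
Variables (p p' q q' u : Cplx R -> Cplx R) (a : nat -> Cplx R -> Cplx R).
Hypothesis oD : open D.
Hypothesis dp : derivative_on D p p'.
Hypothesis dp' : derivative_on D p' (u * p).
Hypothesis dq : derivative_on D q q'.
Hypothesis dq' : derivative_on D q' (u * q).
Hypothesis uE : forall x, D x -> u x = - 2 * (q x * p x) + 2 * x.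
Hypothesis aP : coef_recurrence D p q a.

(** The relation [uE] expresses [u] through [p], [q] and [x], so no third derivative of [p] or [q]
    is required. *)
Let du : derivative_on D u (fun x => 2 - 2 * (q' x * p x + q x * p' x)).
Proof.
move=> x Dx.
have uE' : {in D, u =1 cst (- 2) * (q * p) + cst 2 * id}.
  by move=> y; rewrite inE => /uE ->.
have d := is_deriveD
  (is_derive_mul (is_derive_cst (- 2 : Cplx R) x 1)
    (is_derive_mul (dq Dx) (dp Dx)))
  (is_derive_mul (is_derive_cst (2 : Cplx R) x 1) (is_derive_id x 1)).
apply: (is_derive_open oD Dx uE' d).
rewrite /=; ring.
Qed.

Let a0 x : D x -> a 0 x = p x. Proof. by case: aP => + _; apply. Qed.

Let a1 x : D x -> a 1 x = (a 0)^`()%classic x.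
Proof.
case: aP => _ aS Dx; rewrite aS// big1 ?mulr0 ?addr0// => i _.
by rewrite big1// => j; rewrite !ord1.
Qed.

Let aS n x : D x ->
  a n.+2 x = (a n.+1)^`()%classic x + q x * conv (a^~ x) (a^~ x) n.
Proof.
case: aP => _ aS Dx; rewrite aS//; congr (_ + _ * _).
(* The last outer index [i = n + 1] admits no [j]; every other [i] admits exactly [j = n - i]. *)
rewrite /conv big_ord_recr /= [X in _ + X]big1 ?addr0; last first.
  by move=> j; lia.
apply: eq_bigr => -[i lt_in] _ /=.
rewrite (big_pred1 (inord (n - i))) ?inordK//; first lia.
by move=> j; rewrite /= -val_eqE /= inordK; lia.
Qed.

Let derP n x : D x ->
  is_derive x 1 (a n) (dcoef (p' x) (q' x) (u x) (a^~ x) n).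
Proof.
exact: (is_derive_coef oD dp dp' dq dq' du (fun _ _ => erefl) a0 a1 aS).
Qed.

Lemma holomorphic_coef n : holomorphic_on D (a n).
Proof. by move=> x Dx; have [] := derP n Dx. Qed.

Lemma riccati_coef : laurent_eq_on D
  (2%:R%:L * 't^1 * lderiv (lseries a))%L
  (- (q'%:L - 't^1 * q%:L) * (lseries a * lseries a)
   + (u%:L * 't^1 + 2%:R%:L - 't^3) * lseries a
   + 't^2 * (p'%:L + 't^1 * p%:L))%L.
Proof.
move=> m x Dx.
have derE n : (a n)^`()%classic x = dcoef (p' x) (q' x) (u x) (a^~ x) n.
  by rewrite derive1E; have [] := derP n Dx.
rewrite lcoef_riccati_lhs lcoef_riccati_rhs !lcoef_series_mul.
(* At [t^(-n)] the recurrence removes [a n.+3] and leaves the formula for the derivative of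
   [a n.+2]. The exponents 1, 2, 3 concern [a 2], [a 1], [a 0]; above 3 both sides vanish. *)
have [[n ->]|m_gt0] : (exists n : nat, m = - n%:Z) \/ (0 < m).
  by case: (ltP 0 m) => [|?]; [right|left; exists `|m|%N; lia].
- have -> : - n%:Z - 1 = - n.+1%:Z by lia.
  have -> : - n%:Z - 3 = - n.+3%:Z by lia.
  rewrite !lcoef_series ifF ?ifF; try lia.
  rewrite mulrNz -pmulrn !addr0 -(mulr_natl (a n)) !fctE !natmulfctE.
  by rewrite aS// derE /= !convE; ring.
- case: m m_gt0 => [[|[|[|[|m]]]]|] // _.
  + have -> : 1%:Z - 1 = - 0%:Z by []; have -> : 1%:Z - 3 = - 2%:Z by [].
    rewrite !lcoef_series !lcoef_series_gt0//= mul0rz.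
    rewrite !fctE !natmulfctE aS// derE /=.
    rewrite !convE; ring.
  + have -> : 2%:Z - 1 = 1%:Z by []; have -> : 2%:Z - 3 = - 1%:Z by [].
    rewrite !lcoef_series !lcoef_series_gt0//= mul0rz.
    rewrite !fctE !natmulfctE a1// derE /=.
    ring.
  + have -> : 3%:Z - 1 = 2%:Z by []; have -> : 3%:Z - 3 = - 0%:Z by [].
    rewrite !lcoef_series !lcoef_series_gt0//= mul0rz !fctE !natmulfctE a0//.
    ring.
  + rewrite !lcoef_series_gt0; try lia.
    rewrite mul0rz !fctE !natmulfctE; ring.
Qed.
End RiccatiSolution.

Unset Implicit Arguments.
Set Strict Implicit.

Theorem proposition2p6 (R : realType) (D : set (Cplx R))
  (phi phi' phi'' psi psi' psi'' : Cplx R -> Cplx R) (alpha : Cplx R)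
  (a b : nat -> Cplx R -> Cplx R) :
  domain D ->
  derivative_on D phi phi' -> derivative_on D phi' phi'' ->
  derivative_on D psi psi' -> derivative_on D psi' psi'' ->
  (forall x, D x -> phi x != 0) ->
  (forall x, D x -> psi x != 0) ->
  (forall x, D x -> psi'' x / psi x = phi'' x / phi x /\
     phi'' x / phi x = - 2%:R * psi x * phi x + 2%:R * x) ->
  (forall x, D x -> phi' x * psi x - phi x * psi' x = 2%:R * alpha) ->
  coef_recurrence D phi psi a ->
  coef_recurrence D psi phi b ->
  [/\ forall n, holomorphic_on D (a n),
      forall n, holomorphic_on D (b n),
      let F := lseries a in
      laurent_eq_on D
        (2%:R%:L * 't^1 * lderiv F)%L
        (- (psi'%:L - 't^1 * psi%:L) * (F * F)
         + ((fun x => psi'' x / psi x)%:L * 't^1 + 2%:R%:L - 't^3) * F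
         + 't^2 * (phi'%:L + 't^1 * phi%:L))%L
    & let G := lseries b in
      laurent_eq_on D
        (2%:R%:L * 't^1 * lderiv G)%L
        (- (phi'%:L - 't^1 * phi%:L) * (G * G)
         + ((fun x => phi'' x / phi x)%:L * 't^1 + 2%:R%:L - 't^3) * G
         + 't^2 * (psi'%:L + 't^1 * psi%:L))%L].
Proof.
move=> [oD _ _] dp dp' dq dq' p0 q0 uP _ aP bP.
have uE x : D x -> psi'' x / psi x = - 2 * (psi x * phi x) + 2 * x.
  by move=> /uP[-> ->]; rewrite mulrA.
have uE' x : D x -> phi'' x / phi x = - 2 * (phi x * psi x) + 2 * x.
  by move=> /uP[_ ->]; rewrite [phi x * _]mulrC mulrA.
(* Since the two quotients agree on [D], either of them can serve as [u] for both functions. *)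
have dpu : derivative_on D phi' ((fun x => psi'' x / psi x) * phi).
  move=> x Dx; rewrite mulrfctE; have [-> _] := uP x Dx.
  by rewrite divfK ?p0//; exact: dp'.
have dqu : derivative_on D psi' ((fun x => psi'' x / psi x) * psi).
  by move=> x Dx; rewrite mulrfctE divfK ?q0//; exact: dq'.
have dpu' : derivative_on D phi' ((fun x => phi'' x / phi x) * phi).
  by move=> x Dx; rewrite mulrfctE divfK ?p0//; exact: dp'.
have dqu' : derivative_on D psi' ((fun x => phi'' x / phi x) * psi).
  move=> x Dx; rewrite mulrfctE; have [<- _] := uP x Dx.
  by rewrite divfK ?q0//; exact: dq'.
split.
(* The claims about [b] are those about [a] with [phi] and [psi] exchanged. *)
- exact: (holomorphic_coef oD dp dpu dq dqu uE aP).
- exact: (holomorphic_coef oD dq dqu' dp dpu' uE' bP).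
- exact: (riccati_coef oD dp dpu dq dqu uE aP).
- exact: (riccati_coef oD dq dqu' dp dpu' uE' bP).
Qed.
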